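(* Let $n\ge 1$. With the sets defined in the context, the following hold. (i) The chains of inclusions $$\mathcal{S}_n^+ \cup \mathcal{N}_n \subseteq \mathcal{G}_n = \mathrm{com}(\mathcal{S}_n^+, \mathcal{N}_n) \subseteq \widehat{\mathcal{G}_n} \subseteq \mathcal{S}_n^+ + \mathcal{N}_n,$$ $$\mathcal{S}_n^+ \cup \mathcal{N}_n \subseteq \mathcal{F}_n^{+} \subseteq \widehat{\mathcal{F}_n^{+}} \subseteq \mathcal{S}_n^+ + \mathcal{N}_n,$$ $$\mathcal{S}_n^+ \cup \mathcal{N}_n \subseteq \mathcal{F}_n^{\pm} \subseteq \widehat{\mathcal{F}_n^{\pm}} \subseteq \mathcal{S}_n^+ + \mathcal{N}_n$$ hold, and moreover $\mathcal{G}_n\subseteq\mathcal{F}_n^{+}\subseteq\mathcal{F}_n^{\pm}$ and $\widehat{\mathcal{G}_n}\subseteq\widehat{\mathcal{F}_n^{+}}\subseteq\widehat{\mathcal{F}_n^{\pm}}$. (ii) If $n=2$, then each of the sets $\mathcal{F}_n^{+}$, $\widehat{\mathcal{F}_n^{+}}$, $\mathcal{F}_n^{\pm}$ and $\widehat{\mathcal{F}_n^{\pm}}$ coincides with $\mathcal{S}_n^+ + \mathcal{N}_n$. (iii) The convex hull of each of the sets $\mathcal{F}_n^{+}$, $\widehat{\mathcal{F}_n^{+}}$, $\mathcal{F}_n^{\pm}$ and $\widehat{\mathcal{F}_n^{\pm}}$ is $\mathcal{S}_n^+ + \mathcal{N}_n$.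
   Context: $\mathcal{S}_n$ is the space of real symmetric $n\times n$ matrices; $\mathcal{S}_n^+\subseteq\mathcal{S}_n$ is the cone of positive semidefinite matrices; $\mathcal{N}_n\subseteq\mathcal{S}_n$ is the cone of symmetric matrices with all entries nonnegative; $\mathcal{S}_n^+ + \mathcal{N}_n$ is their Minkowski sum. $\mathcal{O}_n$ is the set of $n\times n$ real orthogonal matrices and $\mathcal{D}_n$ the set of $n\times n$ real diagonal matrices. $\mathrm{com}(\mathcal{S}_n^+,\mathcal{N}_n) := \{S+N \mid S\in\mathcal{S}_n^+,\ N\in\mathcal{N}_n,\ SN=NS\}$. For $p,q\in\mathbb{R}^n$ put $\Pi_+(p,q):=\frac14(p+q)(p+q)^T$ and $\Pi_-(p,q):=\frac14(p-q)(p-q)^T$. For $P=[p_1,\dots,p_n]\in\mathbb{R}^{n\times n}$ (columns $p_k$) and $\Lambda=\mathrm{Diag}(\lambda_1,\dots,\lambda_n)\in\mathcal{D}_n$, define three optimal values of linear programs (each program has an optimal solution): - $\alpha_*(P,\Lambda)$: maximize $\alpha$ over $\omega_1,\dots,\omega_n,\alpha\in\mathbb{R}$ subject to $\omega_i\le\lambda_i$ $(1\le i\le n)$ and $\left[\sum_{k=1}^n\omega_kp_kp_k^T\right]_{ij}\ge\alpha$ $(1\le i\le j\le n)$. - $\alpha_*^{+}(P,\Lambda)$: maximize $\alpha$ over $\alpha\in\mathbb{R}$ and $\omega^+_{kl}\in\mathbb{R}$ $(1\le k\le l\le n)$ subject to $\omega^+_{ii}\le\lambda_i$ $(1\le i\le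 n)$, $\omega^+_{ij}\le 0$ $(1\le i<j\le n)$, and $\left[\sum_{1\le k\le l\le n}\omega^+_{kl}\Pi_+(p_k,p_l)\right]_{ij}\ge\alpha$ $(1\le i\le j\le n)$. - $\alpha_*^{\pm}(P,\Lambda)$: maximize $\alpha$ over $\alpha\in\mathbb{R}$, $\omega^+_{kl}\in\mathbb{R}$ $(1\le k\le l\le n)$ and $\omega^-_{kl}\in\mathbb{R}$ $(1\le k<l\le n)$ subject to $\omega^+_{ii}\le\lambda_i$ $(1\le i\le n)$, $\omega^+_{ij}\le0$ and $\omega^-_{ij}\le 0$ $(1\le i<j\le n)$, and $\left[\sum_{1\le k\le l\le n}\omega^+_{kl}\Pi_+(p_k,p_l)+\sum_{1\le k<l\le n}\omega^-_{kl}\Pi_-(p_k,p_l)\right]_{ij}\ge\alpha$ $(1\le i\le j\le n)$. Define $\mathcal{G}_n$ (respectively $\mathcal{F}_n^{+}$, $\mathcal{F}_n^{\pm}$) as the set of $A\in\mathcal{S}_n$ for which there is $(P,\Lambda)\in\mathcal{O}_n\times\mathcal{D}_n$ with $A=P\Lambda P^T$ and $\alpha_*(P,\Lambda)\ge0$ (respectively $\alpha_*^{+}(P,\Lambda)\ge0$, $\alpha_*^{\pm}(P,\Lambda)\ge0$). Define $\widehat{\mathcal{G}_n}$ (respectively $\widehat{\mathcal{F}_n^{+}}$, $\widehat{\mathcal{F}_n^{\pm}}$) in the same way, but with $(P,\Lambda)$ ranging over $\mathbb{R}^{n\times n}\times\mathcal{D}_n$ instead of $\mathcal{O}_n\times\mathcal{D}_n$.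 *)

(* Defs.v *)
From mathcomp Require Import all_boot all_order all_algebra.
From mathcomp Require Import all_classical all_reals all_analysis.

Set Implicit Arguments.
Unset Strict Implicit.
Unset Printing Implicit Defensive.

Import Order.TTheory GRing.Theory Num.Theory.

Local Open Scope classical_set_scope.
Local Open Scope ring_scope.

Section MatrixSets.
Variables (R : realType) (n : nat).

Definition symmx : set 'M[R]_n := [set A | A^T = A].

Definition psdmx : set 'M[R]_n :=
  [set A | symmx A /\ forall x : 'cV[R]_n, 0 <= (x^T *m A *m x) 0 0].

Definition nnegmx : set 'M[R]_n :=
  [set A | symmx A /\ forall i j, 0 <= A i j].

Definition orthogonalmx : set 'M[R]_n := [set P | P^T *m P = 1%:M].

Definition diagonalmx : set 'M[R]_n := [set L | is_diag_mx L].

Definition minkowski_sum (X Y : set 'M[R]_n) : set 'M[R]_n :=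
  [set A | exists S N, [/\ X S, Y N & A = S + N]].

Definition com (X Y : set 'M[R]_n) : set 'M[R]_n :=
  [set A | exists S N, [/\ X S, Y N, S *m N = N *m S & A = S + N]].

Definition convex_hull (X : set 'M[R]_n) : set 'M[R]_n :=
  smallest (@convex_set R 'M[R]_n) X.

End MatrixSets.

Arguments symmx : clear implicits.
Arguments psdmx : clear implicits.
Arguments nnegmx : clear implicits.
Arguments orthogonalmx : clear implicits.
Arguments diagonalmx : clear implicits.

Section LinearPrograms.
Variables (R : realType) (n : nat).

Definition Pi_plus (p q : 'cV[R]_n) : 'M[R]_n :=
  4%:R^-1 *: ((p + q) *m (p + q)^T).

Definition Pi_minus (p q : 'cV[R]_n) : 'M[R]_n :=
  4%:R^-1 *: ((p - q) *m (p - q)^T).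

(* In the families w, wp, wm below, a double index (k, l) is meaningful only
   for k <= l (resp. k < l); the other values are unconstrained and unused. *)

Definition comb (P : 'M[R]_n) (w : 'I_n -> R) : 'M[R]_n :=
  \sum_(k < n) w k *: (col k P *m (col k P)^T).

Definition comb_plus (P : 'M[R]_n) (wp : 'I_n -> 'I_n -> R) : 'M[R]_n :=
  \sum_(k < n) \sum_(l < n | (k <= l)%N) wp k l *: Pi_plus (col k P) (col l P).

Definition comb_minus (P : 'M[R]_n) (wm : 'I_n -> 'I_n -> R) : 'M[R]_n :=
  \sum_(k < n) \sum_(l < n | (k < l)%N) wm k l *: Pi_minus (col k P) (col l P).

Definition entries_ge (M : 'M[R]_n) (a : R) : Prop :=
  forall i j : 'I_n, (i <= j)%N -> a <= M i j.

Definition feasible (P L : 'M[R]_n) (w : 'I_n -> R) (a : R) : Prop :=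
  (forall i, w i <= L i i) /\ entries_ge (comb P w) a.

Definition feasible_plus (P L : 'M[R]_n) (wp : 'I_n -> 'I_n -> R) (a : R)
    : Prop :=
  [/\ forall i, wp i i <= L i i,
      forall i j : 'I_n, (i < j)%N -> wp i j <= 0 &
      entries_ge (comb_plus P wp) a].

Definition feasible_pm (P L : 'M[R]_n) (wp wm : 'I_n -> 'I_n -> R) (a : R)
    : Prop :=
  [/\ forall i, wp i i <= L i i,
      forall i j : 'I_n, (i < j)%N -> wp i j <= 0 /\ wm i j <= 0 &
      entries_ge (comb_plus P wp + comb_minus P wm) a].

(* Optimal values are suprema in \bar R, so that no default value can be
   mistaken for an optimal value. For 0 < n the programs are feasible and
   bounded, hence these suprema are real numbers. *)

Definition alpha (P L : 'M[R]_n) : \bar R :=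
  ereal_sup [set a%:E | a in [set a | exists w, feasible P L w a]].

Definition alpha_plus (P L : 'M[R]_n) : \bar R :=
  ereal_sup [set a%:E | a in [set a | exists wp, feasible_plus P L wp a]].

Definition alpha_pm (P L : 'M[R]_n) : \bar R :=
  ereal_sup
    [set a%:E | a in [set a | exists wp wm, feasible_pm P L wp wm a]].

Definition factor_set (U : set 'M[R]_n) (val : 'M[R]_n -> 'M[R]_n -> \bar R)
    : set 'M[R]_n :=
  [set A | symmx R n A /\ exists P L : 'M[R]_n,
     [/\ U P, diagonalmx R n L, A = P *m L *m P^T & (0 <= val P L)%E]].

Definition G := factor_set (orthogonalmx R n) alpha.
Definition F_plus := factor_set (orthogonalmx R n) alpha_plus.
Definition F_pm := factor_set (orthogonalmx R n) alpha_pm.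

Definition G_hat := factor_set setT alpha.
Definition F_plus_hat := factor_set setT alpha_plus.
Definition F_pm_hat := factor_set setT alpha_pm.

End LinearPrograms.

Arguments G : clear implicits.
Arguments F_plus : clear implicits.
Arguments F_pm : clear implicits.
Arguments G_hat : clear implicits.
Arguments F_plus_hat : clear implicits.
Arguments F_pm_hat : clear implicits.

(* Main.v *)
(* Each linear program constrains a combination of rank-one matrices
   [w_t v_t v_t^T] with [w_t <= u_t]. The diagonal entries bound the useful
   weights from below, so by compactness a nonnegative supremum yields weights
   [w <= u] with [sum w_t v_t v_t^T >= 0] entrywise; the remainder
   [sum (u_t - w_t) v_t v_t^T] is positive semidefinite, whence the inclusions
   in [PSD + NN]. Commuting symmetric matrices are simultaneously diagonalised
   by an orthogonal matrix, which gives [com PSD NN `<=` G]. For [n = 2] the sum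
   [PSD + NN] is just the union, and [S + N = (2 S + 2 N) / 2] gives the convex
   hulls. *)
Require Import Defs.
From mathcomp Require Import all_boot all_order all_algebra.
From mathcomp Require Import all_classical all_reals all_analysis.
From mathcomp Require Import ring lra.

Set Implicit Arguments.
Unset Strict Implicit.
Unset Printing Implicit Defensive.

Import Order.TTheory GRing.Theory Num.Theory.
Import numFieldNormedType.Exports.

Local Open Scope classical_set_scope.
Local Open Scope ring_scope.

Lemma continuous_sum (R : realType) (T : topologicalType) (I : finType)
    (F : I -> T -> R) :
  (forall i, continuous (F i)) -> continuous (fun x => \sum_i F i x).
Proof.
move=> cF; apply: (@continuous_big R I +%R 0 xpredT (@add_continuous R) T) => i _.
exact: cF.
Qed.

(** * Simultaneous orthogonal diagonalisation of commuting symmetric matrices *)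

Section Spectral.
Variable R : realType.

Lemma quad_continuous n (A : 'M[R]_n) :
  continuous (fun x : 'rV[R]_n => (x *m A *m x^T) 0 0).
Proof.
have -> : (fun x : 'rV[R]_n => (x *m A *m x^T) 0 0) =
    (fun x => \sum_j (\sum_i x 0 i * A i j) * x 0 j).
  by apply/funext => x; rewrite mxE; apply: eq_bigr => j _; rewrite !mxE.
apply: continuous_sum => j x.
apply: continuousM; last exact: coord_continuous.
apply: (@continuous_sum R _ _ (fun i (x : 'rV[R]_n) => x 0 i * A i j)) => i y.
by apply: continuousM; [exact: coord_continuous | exact: cst_continuous].
Qed.

Lemma quad_rV_sum n (x : 'rV[R]_n) : (x *m x^T) 0 0 = \sum_i x 0 i ^+ 2.
Proof. by rewrite mxE; apply: eq_bigr => i _; rewrite mxE expr2. Qed.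

Lemma quad_rV_ge0 n (x : 'rV[R]_n) : 0 <= (x *m x^T) 0 0.
Proof. by rewrite quad_rV_sum sumr_ge0 // => i _; rewrite sqr_ge0. Qed.

Lemma quad_rV_eq0 n (x : 'rV[R]_n) : (x *m x^T) 0 0 = 0 -> x = 0.
Proof.
rewrite quad_rV_sum => /eqP; rewrite psumr_eq0 => [|i _]; last exact: sqr_ge0.
move=> /allP x0; apply/rowP => i; rewrite mxE.
by have := x0 i (mem_index_enum _); rewrite /= sqrf_eq0 => /eqP.
Qed.

Lemma quadZ n (k : R) (x : 'rV[R]_n) (A : 'M[R]_n) :
  (k *: x *m A *m (k *: x)^T) 0 0 = k ^+ 2 * (x *m A *m x^T) 0 0.
Proof.
by rewrite linearZ /= -!scalemxAl -scalemxAr scalerA -expr2 [LHS]mxE.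
Qed.

Lemma quadDZ n (B : 'M[R]_n) (x y : 'rV[R]_n) (t : R) :
  ((x + t *: y) *m B *m (x + t *: y)^T) 0 0 =
  (x *m B *m x^T) 0 0 + t * ((y *m B *m x^T) 0 0 + (x *m B *m y^T) 0 0)
  + t ^+ 2 * (y *m B *m y^T) 0 0.
Proof.
have addE (U V : 'M[R]_1) : (U + V) 0 0 = U 0 0 + V 0 0 by rewrite mxE.
have scaleE k (U : 'M[R]_1) : (k *: U) 0 0 = k * U 0 0 by rewrite mxE.
rewrite [(_ + _)^T]linearD /= [(_ *: _)^T]linearZ /= !(mulmxDl, mulmxDr).
by rewrite -!(scalemxAl, scalemxAr) !(addE, scaleE); ring.
Qed.

(* [x] maximises the Rayleigh quotient of [A] on the kernel of [M]; the form
   [x A x^T - m x x^T] is then nonpositive there and vanishes at the maximiser,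
   which forces [x A = m x]. *)
Lemma eigenvector_in_kernel n (A M : 'M[R]_n) :
  A^T = A -> (exists2 x : 'rV[R]_n, x *m M = 0 & x != 0) ->
  (forall x : 'rV[R]_n, x *m M = 0 -> x *m A *m M = 0) ->
  exists (x : 'rV[R]_n) (m : R),
    [/\ (x *m x^T) 0 0 = 1, x *m M = 0 & x *m A = m *: x].
Proof.
move=> symA [y yM y0] stabM.
pose K := [set x : 'rV[R]_n | x *m M = 0 /\ (x *m x^T) 0 0 = 1].
have normalize (z : 'rV[R]_n) : z != 0 -> z *m M = 0 ->
    K ((Num.sqrt ((z *m z^T) 0 0))^-1 *: z).
  move=> z0 zM; split; first by rewrite -scalemxAl zM scaler0.
  have q0 : (z *m z^T) 0 0 != 0 by apply: contra_neq z0 => /quad_rV_eq0.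
  have /[!mulmx1] -> := quadZ (Num.sqrt ((z *m z^T) 0 0))^-1 z 1%:M.
  by rewrite exprVn sqr_sqrtr ?quad_rV_ge0 // mulVf.
(* As [x (M M^T) x^T] is the squared length of [x M], the unit sphere of the kernel is cut out by
   level sets of two continuous quadratic forms, hence closed. *)
have KE : K = (fun x : 'rV[R]_n => (x *m (M *m M^T) *m x^T) 0 0) @^-1` [set 0]
   `&` (fun x : 'rV[R]_n => (x *m 1%:M *m x^T) 0 0) @^-1` [set 1].
  apply/seteqP; split => x /=; rewrite mulmx1.
    by move=> [xM x1]; split=> //; rewrite mulmxA xM !mul0mx mxE.
  move=> [xM x1]; split=> //; apply: quad_rV_eq0.
  by rewrite trmx_mul !mulmxA -xM !mulmxA.
have Kclosed : closed K.
  rewrite KE; apply: closedI.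
  - apply: closed_comp => [x _|]; first exact: quad_continuous.
    exact: closed_eq.
  - apply: closed_comp => [x _|]; first exact: quad_continuous.
    exact: closed_eq.
have Kbounded : bounded_set K.
  exists 1; split=> // r r1 x [_ x1] /=.
  rewrite [leLHS]/Num.norm /= mx_normrE; apply/bigmax_leP; split=> [|[i j] _] /=.
    by rewrite (le_trans ler01) // ltW.
  rewrite (ord1 i); apply: le_trans (ltW r1).
  rewrite -(@ler_pXn2r _ 2%N) ?nnegrE // expr1n real_normK ?num_real //.
  rewrite -x1 quad_rV_sum (bigD1 j) //= lerDl sumr_ge0 // => k _.
  exact: sqr_ge0.
have [] := @EVT_max_rV R n (fun x => (x *m A *m x^T) 0 0) K.
- by exists ((Num.sqrt ((y *m y^T) 0 0))^-1 *: y); exact: normalize.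
- exact: bounded_closed_compact.
- by apply: continuous_subspaceT => x; exact: quad_continuous.
move=> c; rewrite inE => -[cM c1] cmax.
set m := (c *m A *m c^T) 0 0 in cmax.
exists c, m; split=> //.
pose B := m%:M - A.
have symB : B^T = B by rewrite linearB /= tr_scalar_mx symA.
have quadB (x : 'rV[R]_n) :
    (x *m B *m x^T) 0 0 = m * (x *m x^T) 0 0 - (x *m A *m x^T) 0 0.
  by rewrite mulmxBr mulmxBl mul_mx_scalar -scalemxAl !mxE.
have Bge0 (x : 'rV[R]_n) : x *m M = 0 -> 0 <= (x *m B *m x^T) 0 0.
  move=> xM; have [->|x0] := eqVneq x 0; first by rewrite !mul0mx mxE.
  have := cmax _ (mem_set (normalize _ x0 xM)).
  set q := (x *m x^T) 0 0; have q_gt0 : 0 < q.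
    by rewrite lt0r quad_rV_ge0 andbT; apply: contra_neq x0 => /quad_rV_eq0.
  rewrite quadZ exprVn sqr_sqrtr ?quad_rV_ge0 // -/q.
  rewrite -(ler_pM2l q_gt0) mulVKf ?gt_eqF // quadB -/q => h.
  by rewrite subr_ge0 mulrC.
have cBc : (c *m B *m c^T) 0 0 = 0 by rewrite quadB c1 mulr1 subrr.
suff z0 : c *m B = 0.
  by apply/eqP; rewrite eq_sym -subr_eq0 -mul_mx_scalar -mulmxBr z0.
set z := c *m B; apply: quad_rV_eq0.
have zM : z *m M = 0.
  by rewrite /z mulmxBr mulmxBl mul_mx_scalar -scalemxAl cM scaler0 stabM // subrr.
(* Perturb the maximiser [c] in the direction [z = c B]: the constant term vanishes, and the linear
   coefficient is twice the squared length of [z]. *)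
have expand t : (((c + t *: z) *m B) *m (c + t *: z)^T) 0 0 =
    2 * t * (z *m z^T) 0 0 + t ^+ 2 * (z *m B *m z^T) 0 0.
  have zc : (z *m B *m c^T) 0 0 = (z *m z^T) 0 0.
    by rewrite -mulmxA -{1}symB -trmx_mul.
  by rewrite quadDZ cBc zc -/z; ring.
have pos t : 0 <= 2 * t * (z *m z^T) 0 0 + t ^+ 2 * (z *m B *m z^T) 0 0.
  by rewrite -expand Bge0 // mulmxDl cM add0r -scalemxAl zM scaler0.
have := quad_rV_ge0 z; have := Bge0 _ zM.
set q := (z *m z^T) 0 0 in pos *; set g := (z *m B *m z^T) 0 0 in pos *.
move=> g0 q0; apply/eqP; rewrite eq_le q0 andbT.
(* Nonnegativity of [2 t q + t^2 g] for all [t] forces [q = 0]. If [g = 0], take [t = -1]; otherwise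
   take the minimiser [t = - q / g], where the value is [- q^2 / g]. *)
have [gz|gn] := eqVneq g 0; first by have := pos (-1); rewrite gz; lra.
have := pos (- (q / g)).
have -> : 2 * - (q / g) * q + (- (q / g)) ^+ 2 * g = - (q ^+ 2 / g) by field.
rewrite oppr_ge0 pmulr_lle0 ?invr_gt0 ?lt0r ?gn // => h.
by have /eqP := le_anti (introT andP (conj h (sqr_ge0 q)));
  rewrite sqrf_eq0 => /eqP ->.
Qed.

(** A Householder reflection along [x - e] works. It is symmetric and involutive, so conjugation by
    it preserves symmetry and is its own inverse. *)
Lemma orthogonal_first_row n (x : 'rV[R]_n.+1) :
  (x *m x^T) 0 0 = 1 ->
  exists H : 'M[R]_n.+1,
    [/\ H^T = H, H *m H = 1%:M & delta_mx 0 0 *m H = x].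
Proof.
move=> x1; set e : 'rV[R]_n.+1 := delta_mx 0 0.
have e1 : (e *m e^T) 0 0 = 1 by rewrite trmx_delta mul_delta_mx mxE.
(* For [x = e] the direction [x - e] vanishes and the identity takes the place of the reflection. *)
have [<-|xe] := eqVneq e x.
  by exists 1%:M; rewrite trmx1 !mulmx1.
pose v := x - e; pose q := (v *m v^T) 0 0.
have q0 : q != 0.
  by apply: contra_neq xe => /quad_rV_eq0 /eqP; rewrite subr_eq0 => /eqP ->.
have vv : v *m v^T = q%:M by rewrite [LHS]mx11_scalar.
(* The reflection exchanging [x] and [e]. *)
exists (1%:M - (2 / q) *: (v^T *m v)); split.
- by rewrite linearB /= trmx1 linearZ /= trmx_mul trmxK.
- have WW : v^T *m v *m (v^T *m v) = q *: (v^T *m v).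
    by rewrite -mulmxA (mulmxA v) vv mul_scalar_mx -scalemxAr.
  move: (v^T *m v) WW => W WW.
  rewrite mulmxBl !mulmxBr !mulmx1 mul1mx -scalemxAl -scalemxAr WW !scalerA.
  rewrite opprB addrA -addrA -addrA [X in _ + X](_ : _ = 0) ?addr0 //.
  rewrite -scaleNr -!scalerDl [X in X *: _](_ : _ = 0) ?scale0r //.
  by field.
- have ex : (e *m x^T) 0 0 = (x *m e^T) 0 0.
    by rewrite -[e in LHS]trmxK -trmx_mul mxE.
  have qE : q = 2 - 2 * (x *m e^T) 0 0.
    have := quadDZ 1%:M x e (- 1).
    by rewrite scaleN1r !mulmx1 -/v -/q x1 e1 ex => ->; ring.
  have ev : (e *m v^T = (- (q / 2))%:M).
    rewrite [LHS]mx11_scalar; congr (_%:M).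
    by rewrite /v linearB /= mulmxBr mxE [X in _ + X]mxE e1 ex qE; field.
  rewrite mulmxBr mulmx1 -scalemxAr mulmxA ev mul_scalar_mx scalerA.
  rewrite mulrN scaleNr opprK mulf_div [X in X *: _](_ : _ = 1) ?scale1r.
    by rewrite /v addrC subrK.
  by field.
Qed.

(** The eigenvector equation fixes the first row of [A], and symmetry transfers its zeros to the
    first column. *)
Lemma deflate n (A : 'M[R]_(1 + n)) (m : R) :
  A^T = A -> delta_mx 0 0 *m A = m *: (delta_mx 0 0 : 'rV[R]_(1 + n)) ->
  A = block_mx m%:M 0 0 (drsubmx A) /\ (drsubmx A)^T = drsubmx A.
Proof.
move=> symA eA; split; last by rewrite trmx_drsub symA.
have A0 j : A 0 j = m * (j == 0)%:R.
  by have /rowP/(_ j) := eA; rewrite -rowE !mxE.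
have ur0 : ursubmx A = 0.
  by apply/matrixP => i j; rewrite (ord1 i) !mxE lshift0 A0 mulr0.
have dl0 : dlsubmx A = 0 by rewrite -symA -trmx_ursub ur0 trmx0.
rewrite -[LHS]submxK ur0 dl0.
congr block_mx; apply/matrixP => i j.
by rewrite (ord1 i) (ord1 j) !mxE lshift0 A0 eqxx mulr1.
Qed.

(** Induction on the size. An eigenspace of [A] is stable under [B] because they commute, so it
    contains an eigenvector of [B]. A reflection moves this common eigenvector to the first basis
    row; both matrices then split, and their lower right blocks are again symmetric and commute. *)
Lemma orthogonal_codiag n (A B : 'M[R]_n) :
  A^T = A -> B^T = B -> A *m B = B *m A ->
  exists (P : 'M[R]_n) (a b : 'rV[R]_n),
    [/\ P^T *m P = 1%:M, A = P *m diag_mx a *m P^T & B = P *m diag_mx b *m P^T].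
Proof.
elim: n A B => [|n IHn] A B symA symB AB.
  by exists 1%:M, 0, 0; split; apply/matrixP => -[].
(* With [M = 0] the kernel is the whole space, so this only yields some eigenvalue [m] of [A]. *)
have [||x [m [x1 _ xA]]] := @eigenvector_in_kernel _ A 0 symA.
- exists (delta_mx 0 0); first exact: mulmx0.
  by apply/eqP => /rowP/(_ 0)/eqP; rewrite !mxE oner_eq0.
- by move=> x _; exact: mulmx0.
(* The kernel of this [M] is the eigenspace of [A] for [m]. *)
pose M := A - m%:M.
have [||y [k [y1 yM yB]]] := @eigenvector_in_kernel _ B M symB.
- exists x; first by rewrite mulmxBr xA mul_mx_scalar subrr.
  by apply/eqP => x0; move: x1; rewrite x0 mul0mx mxE => /eqP;
    rewrite eq_sym oner_eq0.
- move=> z zM; have BM : B *m M = M *m B.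
    by rewrite mulmxBr mulmxBl AB scalar_mxC.
  by rewrite -mulmxA BM mulmxA zM mul0mx.
have {}yM : y *m A = m *: y.
  by apply/eqP; rewrite -subr_eq0 -mul_mx_scalar -mulmxBr yM.
have [H [symH HH eH]] := orthogonal_first_row y1.
have eHCH (C : 'M[R]_n.+1) (c : R) : y *m C = c *: y ->
    delta_mx 0 0 *m (H *m C *m H) = c *: (delta_mx 0 0 : 'rV[R]_n.+1).
  by move=> yC; rewrite !mulmxA eH yC -scalemxAl -eH -mulmxA HH mulmx1.
have symHCH (C : 'M[R]_n.+1) : C^T = C -> (H *m C *m H)^T = H *m C *m H.
  by move=> symC; rewrite !trmx_mul symC symH mulmxA.
have HCHK (C : 'M[R]_n.+1) : C = H *m (H *m C *m H) *m H.
  by rewrite !mulmxA HH mul1mx -mulmxA HH mulmx1.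
have comm : H *m A *m H *m (H *m B *m H) = H *m B *m H *m (H *m A *m H).
  rewrite !mulmxA -(mulmxA _ H H) HH mulmx1 -(mulmxA _ H H) HH mulmx1.
  by rewrite -(mulmxA H A) AB mulmxA.
set A2 : 'M[R]_(1 + n) := H *m A *m H.
set B2 : 'M[R]_(1 + n) := H *m B *m H.
have [defA symA1] := @deflate n A2 _ (symHCH _ symA) (eHCH _ _ yM).
have [defB symB1] := @deflate n B2 _ (symHCH _ symB) (eHCH _ _ yB).
have commA1 : drsubmx A2 *m drsubmx B2 = drsubmx B2 *m drsubmx A2.
  have : A2 *m B2 = B2 *m A2 by exact: comm.
  rewrite defA defB !mulmx_block !(mul0mx, mulmx0, add0r, addr0).
  by rewrite !block_mxKdr => /(congr1 drsubmx); rewrite !block_mxKdr.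
have [P [a [b [PP defA1 defB1]]]] := IHn _ _ symA1 symB1 commA1.
pose Q : 'M[R]_(1 + n) := block_mx 1%:M 0 0 P.
have QT : Q^T = block_mx 1%:M 0 0 P^T.
  by rewrite tr_block_mx !trmx0 trmx1.
have conjQ (c : R) (d : 'rV[R]_n) :
    block_mx c%:M 0 0 (P *m diag_mx d *m P^T) =
    Q *m diag_mx (row_mx c%:M d) *m Q^T.
  rewrite QT diag_mx_row !mulmx_block !(mul0mx, mulmx0, add0r, addr0).
  rewrite mul1mx mulmx1; congr block_mx.
  by apply/matrixP => i j; rewrite !ord1 !mxE eqxx.
have QQ : Q^T *m Q = 1%:M.
  rewrite QT mulmx_block !(mul0mx, mulmx0, add0r, addr0) mul1mx PP.
  by rewrite -scalar_mx_block.
have defA2 : A2 = Q *m diag_mx (row_mx m%:M a) *m Q^T.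
  by rewrite -conjQ -defA1.
have defB2 : B2 = Q *m diag_mx (row_mx k%:M b) *m Q^T.
  by rewrite -conjQ -defB1.
have HQT : (H *m Q)^T = Q^T *m H by rewrite trmx_mul symH.
exists (H *m Q), (row_mx m%:M a), (row_mx k%:M b); rewrite HQT; split.
- by rewrite -mulmxA (mulmxA H) HH mul1mx QQ.
- by rewrite [LHS]HCHK -/A2 defA2 !mulmxA.
- by rewrite [LHS]HCHK -/B2 defB2 !mulmxA.
Qed.

End Spectral.

(** * Rank-one combinations with bounded weights, and attainment of the value zero *)

Section RankOneCombination.
Variables (R : realType) (n : nat) (T : finType) (v : T -> 'cV[R]_n).

(** The index type is an arbitrary finite type, so that one attainment argument covers both the
    columns of [P] and the half sums and differences of pairs of columns. *)
Definition rank1_comb (w : T -> R) : 'M[R]_n :=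
  \sum_t w t *: (v t *m (v t)^T).

Lemma rank1_combE w i j :
  rank1_comb w i j = \sum_t w t * (v t i 0 * v t j 0).
Proof.
by rewrite summxE; apply: eq_bigr => t _; rewrite !mxE big_ord1 !mxE.
Qed.

Lemma rank1_comb_sym w : (rank1_comb w)^T = rank1_comb w.
Proof.
apply/matrixP => i j; rewrite mxE !rank1_combE.
by apply: eq_bigr => t _; rewrite (mulrC (v t j 0)).
Qed.

Lemma entries_ge_rank1_comb w a :
  entries_ge (rank1_comb w) a -> forall i j, a <= rank1_comb w i j.
Proof.
move=> h i j; have [/h//|/ltnW/h] := leqP i j.
by rewrite -[in X in X -> _]rank1_comb_sym mxE.
Qed.

Lemma psdmx_rank1_comb w :
  (forall t, 0 <= w t) -> psdmx R n (rank1_comb w).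
Proof.
move=> w0; split; first exact: rank1_comb_sym.
move=> x; rewrite mulmx_sumr mulmx_suml summxE sumr_ge0 // => t _.
rewrite -scalemxAr -scalemxAl mxE mulr_ge0 //.
rewrite mulmxA -(mulmxA (x^T *m v t)).
have -> : x^T *m v t = ((v t)^T *m x)^T by rewrite trmx_mul trmxK.
by rewrite mxE big_ord1 !mxE -expr2 sqr_ge0.
Qed.

Lemma rank1_combB u w : rank1_comb u - rank1_comb w = rank1_comb (u \- w).
Proof.
by rewrite /rank1_comb -sumrB; apply: eq_bigr => t _; rewrite scalerBl.
Qed.

Variable u : T -> R.

(* The diagonal entries bound the weights of the nonzero vectors from below. *)
Lemma weight_lower_bound t : v t != 0 ->
  exists l, forall w, (forall s, w s <= u s) ->
    entries_ge (rank1_comb w) (- 1) -> l <= w t.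
Proof.
case/cV0Pn => i vi0.
(* Solve the constraint on the entry [(i, i)] for [w t], after bounding every other weight [w s] by
   [|u s|]. *)
exists ((- 1 - \sum_(s | s != t) `|u s| * (v s i 0 * v s i 0)) / v t i 0 ^+ 2).
move=> w wu w1; rewrite ler_pdivrMr ?exprn_even_gt0 // lerBlDr.
apply: (le_trans (w1 i i (leqnn i))).
rewrite rank1_combE (bigD1 t) //= expr2 lerD2l ler_sum // => s _.
rewrite ler_wpM2r ?(le_trans (wu s)) ?ler_norm //.
by rewrite -expr2 sqr_ge0.
Qed.

Lemma compact_box (l : T -> R) : compact
  [set x : 'rV[R]_#|T| | forall t, x 0 (enum_rank t) \in `[l t, u t]].
Proof.
pose K (i : 'I_#|T|) : set R := [set y | y \in `[l (enum_val i), u (enum_val i)]].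
have /rV_compact : forall i, compact (K i) by move=> i; exact: segment_compact.
congr (compact _); apply/seteqP; split => x /= h t.
  by have := h (enum_rank t); rewrite /K enum_rankK.
by have := h (enum_val t); rewrite enum_valK.
Qed.

(* Weights of zero vectors are irrelevant and the others are bounded, so the
   total negative part of the entries can be minimised over a compact box. *)
Lemma rank1_lp_attained :
  (forall e, 0 < e -> exists w, (forall t, w t <= u t) /\
     entries_ge (rank1_comb w) (- e)) ->
  exists w, (forall t, w t <= u t) /\ entries_ge (rank1_comb w) 0.
Proof.
move=> approx.
have /choice[l l_lb] : forall t, exists l, v t != 0 ->
    forall w, (forall s, w s <= u s) ->
    entries_ge (rank1_comb w) (- 1) -> l <= w t.
  move=> t; have [_|v0] := eqVneq (v t) 0; first by exists 0.
  by have [l Hl] := weight_lower_bound v0; exists l.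
pose of_row (x : 'rV[R]_#|T|) t := x 0 (enum_rank t).
(* For a zero vector [l t] is arbitrary and may exceed [u t]; the minimum keeps the interval
   nonempty. *)
pose K := [set x | forall t, of_row x t \in `[Num.min (l t) (u t), u t]].
have inK e : 0 < e -> e <= 1 ->
    exists2 x, K x & entries_ge (rank1_comb (of_row x)) (- e).
  move=> e0 e1; have [w [wu we]] := approx _ e0.
  (* Resetting the weights of zero vectors to [u t] brings them into the box without changing the
     combination. *)
  pose w' t := if v t == 0 then u t else w t.
  exists (\row_i w' (enum_val i)).
    move=> t /=; rewrite /of_row mxE enum_rankK in_itv /= /w'.
    have [_|v0] := eqVneq; first by rewrite ge_min !lexx orbT.
    rewrite wu ge_min l_lb // => i j ij.
    by apply: le_trans (we i j ij); rewrite lerN2.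
  suff -> : rank1_comb (of_row (\row_i w' (enum_val i))) = rank1_comb w by [].
  apply: eq_bigr => t _; rewrite /of_row mxE enum_rankK /w'.
  by have [->|//] := eqVneq; rewrite mul0mx !scaler0.
pose f x := \sum_i \sum_j Num.min (rank1_comb (of_row x) i j) 0.
have centry i j : continuous (fun x => rank1_comb (of_row x) i j).
  have -> : (fun x => rank1_comb (of_row x) i j) =
      (fun x => \sum_t of_row x t * (v t i 0 * v t j 0)).
    by apply/funext => x; rewrite rank1_combE.
  apply: (@continuous_sum R _ T
    (fun t (x : 'rV[R]_#|T|) => x 0 (enum_rank t) * (v t i 0 * v t j 0))) => t y.
  apply: (@continuousM R _ (fun x : 'rV[R]_#|T| => x 0 (enum_rank t))
    (cst (v t i 0 * v t j 0))); last exact: cst_continuous.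
  exact: coord_continuous.
have cf : continuous f.
  apply: continuous_sum => i; apply: continuous_sum => j x.
  by apply: continuous_min; [exact: centry | exact: cst_continuous].
have [] := EVT_max_rV _ (@compact_box (fun t => Num.min (l t) (u t)))
             (@continuous_subspaceT _ _ _ _ cf).
  by have [x Kx _] := inK 1 ltr01 (lexx 1); exists x.
move=> c; rewrite inE => Kc fmax.
exists (of_row c); split=> [t|i j _].
  by have := Kc t; rewrite /= in_itv /= => /andP[].
have f0 : 0 <= f c.
  apply/ler_addgt0Pr => e e0.
  (* The bound by [1] makes the lower bounds [l] applicable. The other bound makes the [n^2] entries
     lose at most [e] in total, with [n.+1] so that the denominator is nonzero even for [n = 0]. *)
  pose d := Num.min 1 (e / (n.+1%:R ^+ 2)).
  have n0 : 0 < n.+1%:R ^+ 2 :> R by rewrite exprn_gt0.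
  have d0 : 0 < d by rewrite lt_min ltr01 divr_gt0.
  have [|x Kx xd] := inK d d0; first by rewrite ge_min lexx.
  rewrite addrC -lerBlDl sub0r; apply: le_trans (fmax _ (mem_set Kx)).
  have : \sum_(i < n) \sum_(j < n) (- d) <= f x.
    apply: ler_sum => k _; apply: ler_sum => k' _.
    by rewrite le_min (entries_ge_rank1_comb xd) oppr_le0 ltW.
  apply: le_trans; rewrite !sumr_const !card_ord -mulrnA mulNrn lerN2 -mulr_natr.
  have dN : d * n.+1%:R ^+ 2 <= e.
    by rewrite -ler_pdivlMr // ge_min lexx orbT.
  apply: le_trans dN; rewrite ler_pM2l // -natrX ler_nat -mulnn.
  by rewrite leq_mul.
have mle0 i' j' : Num.min (rank1_comb (of_row c) i' j') 0 <= 0.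
  by rewrite ge_min lexx orbT.
(* All summands of [f c] are nonpositive, so the sum is at most each of them; with [0 <= f c] every
   entry is nonnegative. *)
have : f c <= Num.min (rank1_comb (of_row c) i j) 0.
  rewrite /f (bigD1 i) //= (bigD1 j) //= -addrA gerDl -[leRHS](addr0 0) lerD //.
    by rewrite sumr_le0.
  by rewrite sumr_le0 // => i' _; rewrite sumr_le0.
by move=> /(le_trans f0); rewrite le_min => /andP[].
Qed.

End RankOneCombination.

(** This turns a nonnegative optimal value, defined as a supremum, into the approximate feasibility
    from which [rank1_lp_attained] starts. *)
Lemma ereal_sup_ge0_approx (R : realType) (F : set R) :
  (0 <= ereal_sup [set a%:E | a in F])%E ->
  forall e, 0 < e -> exists2 a, F a & - e < a.
Proof.
move=> F0 e e0; have : ((- e)%:E < ereal_sup [set a%:E | a in F])%E.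
  by apply: lt_le_trans F0; rewrite lte_fin oppr_lt0.
by move/ereal_sup_gt => [_ [a Fa <-]]; rewrite lte_fin; exists a.
Qed.

(** * The three programs, the inclusions between their factor sets, and convex hulls *)

Section LinearPrograms.
Variables (R : realType) (n : nat).
Implicit Types (P L : 'M[R]_n) (w : 'I_n -> R) (wp wm : 'I_n -> 'I_n -> R).

Lemma entries_ge_le (M : 'M[R]_n) a b :
  b <= a -> entries_ge M a -> entries_ge M b.
Proof. by move=> ba h i j /h; exact: le_trans. Qed.

Lemma comb_diag_mx P (d : 'rV[R]_n) :
  comb P (d 0) = P *m diag_mx d *m P^T.
Proof.
apply/matrixP => i j; rewrite (@rank1_combE _ _ _ (fun k => col k P)) mxE.
by apply: eq_bigr => k _; rewrite mul_mx_diag !mxE mulrCA mulrA.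
Qed.

Lemma comb_diagonal P L :
  diagonalmx R n L -> P *m L *m P^T = comb P (fun k => L k k).
Proof.
move=> /diag_mxP[d ->]; rewrite -comb_diag_mx.
by apply: eq_bigr => k _; rewrite mxE eqxx.
Qed.

Definition diag_weight w (k l : 'I_n) : R := if k == l then w k else 0.

(** [Pi_plus p p] is [p p^T], so weights supported on the diagonal pairs embed the first program in
    the second. *)
Lemma comb_plus_diag_weight P w : comb_plus P (diag_weight w) = comb P w.
Proof.
apply: eq_bigr => k _; rewrite (bigD1 k) //= big1 ?addr0 => [|l /andP[_ lk]].
  rewrite /diag_weight eqxx /Pi_plus -mulr2n
    -[col k P *+ 2]scaler_nat [(_ *: _)^T]linearZ /=.
  by rewrite -scalemxAl -scalemxAr !scalerA; congr (_ *: _); field.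
by rewrite /diag_weight eq_sym (negPf lk) scale0r.
Qed.

Lemma comb_minus0 P : comb_minus P (fun _ _ => 0) = 0.
Proof.
by rewrite /comb_minus big1 // => k _; rewrite big1 // => l _; rewrite scale0r.
Qed.

Definition pm_index : finType := (('I_n * 'I_n) + ('I_n * 'I_n))%type.

Definition pm_vector P (t : pm_index) : 'cV[R]_n :=
  match t with
  | inl (k, l) => 2^-1 *: (col k P + col l P)
  | inr (k, l) => 2^-1 *: (col k P - col l P)
  end.

Definition pm_weight wp wm (t : pm_index) : R :=
  match t with
  | inl (k, l) => if (k <= l)%N then wp k l else 0
  | inr (k, l) => if (k < l)%N then wm k l else 0
  end.

Lemma comb_pm_rank1 P wp wm :
  comb_plus P wp + comb_minus P wm =
  rank1_comb (pm_vector P) (pm_weight wp wm).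
Proof.
rewrite /rank1_comb big_sumType /=; congr (_ + _).
- rewrite /comb_plus pair_big_dep big_mkcond; apply: eq_bigr => -[k l] _ /=.
  case: ifP => _; last by rewrite scale0r.
  rewrite /Pi_plus [(_ *: _)^T]linearZ /= -scalemxAl -scalemxAr !scalerA.
  by congr (_ *: _); field.
- rewrite /comb_minus pair_big_dep big_mkcond; apply: eq_bigr => -[k l] _ /=.
  case: ifP => _; last by rewrite scale0r.
  rewrite /Pi_minus [(_ *: _)^T]linearZ /= -scalemxAl -scalemxAr !scalerA.
  by congr (_ *: _); field.
Qed.

Lemma feasible_plus_diag_weight P L w a :
  feasible P L w a -> feasible_plus P L (diag_weight w) a.
Proof.
move=> [wL wa]; split; last by rewrite comb_plus_diag_weight.
- by move=> i; rewrite /diag_weight eqxx.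
- by move=> i j; rewrite /diag_weight; case: eqVneq => // ->; rewrite ltnn.
Qed.

Lemma feasible_pm_plus P L wp a :
  feasible_plus P L wp a -> feasible_pm P L wp (fun _ _ => 0) a.
Proof.
move=> [wL w0 wa]; split=> //; last by rewrite comb_minus0 addr0.
by move=> i j ij; split; first exact: w0.
Qed.

Lemma le_alpha_alpha_plus P L : (alpha P L <= alpha_plus P L)%E.
Proof.
apply: ereal_sup_le => _ [a [w wa] <-]; exists a => //.
by exists (diag_weight w); exact: feasible_plus_diag_weight.
Qed.

Lemma le_alpha_plus_pm P L : (alpha_plus P L <= alpha_pm P L)%E.
Proof.
apply: ereal_sup_le => _ [a [w wa] <-]; exists a => //.
by exists w, (fun _ _ => 0); exact: feasible_pm_plus.
Qed.

Lemma factor_set_mono (U V : set 'M[R]_n) val val' :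
  U `<=` V -> (forall P L, (val P L <= val' P L)%E) ->
  factor_set U val `<=` factor_set V val'.
Proof.
move=> UV le_val A [symA [P [L [UP DL AE v0]]]]; split=> //.
by exists P, L; split=> //; [exact: UV | exact: le_trans (le_val _ _)].
Qed.

Lemma alpha_attained P L : (0 <= alpha P L)%E -> exists w, feasible P L w 0.
Proof.
move=> a0; apply: (@rank1_lp_attained _ _ _ (fun k => col k P)).
move=> e /(ereal_sup_ge0_approx a0)[a [w [wL wa]] ea]; exists w; split=> //.
exact: entries_ge_le (ltW ea) wa.
Qed.

Lemma nnegmx_rank1_comb (T : finType) (v : T -> 'cV[R]_n)
    (w : T -> R) :
  entries_ge (rank1_comb v w) 0 -> nnegmx R n (rank1_comb v w).
Proof.
move=> w0; split; first exact: rank1_comb_sym.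
exact: entries_ge_rank1_comb.
Qed.

(** The upper bounds of the program are themselves a weight [u]: the entries of [L] on diagonal
    pairs and zero elsewhere. Its combination is [A], so an attained [w <= u] splits [A] into the
    parts with weights [u - w] and [w]. *)
Lemma F_pm_hat_sub :
  F_pm_hat R n `<=` minkowski_sum (psdmx R n) (nnegmx R n).
Proof.
move=> A [symA [P [L [_ DL AE a0]]]].
pose u := pm_weight (diag_weight (fun k => L k k)) (fun _ _ => 0).
have Au : A = rank1_comb (pm_vector P) u.
  by rewrite -comb_pm_rank1 comb_plus_diag_weight comb_minus0 addr0 -comb_diagonal.
have [|w [wu w0]] := @rank1_lp_attained _ _ _ (pm_vector P) u.
  move=> e /(ereal_sup_ge0_approx a0)[a [wp [wm [wL w0 wa]]] ea].
  exists (pm_weight wp wm); split.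
    case=> -[k l]; rewrite /u /= /diag_weight.
      case: leqP => // kl; have [->//|klN] := eqVneq k l.
      by case: (w0 k l); rewrite // ltn_neqAle klN.
    by case: ltnP => // kl; case: (w0 k l kl).
  by rewrite -comb_pm_rank1; exact: entries_ge_le (ltW ea) wa.
exists (rank1_comb (pm_vector P) (u \- w)), (rank1_comb (pm_vector P) w).
split.
- by apply: psdmx_rank1_comb => t; rewrite subr_ge0.
- exact: nnegmx_rank1_comb.
- by rewrite -rank1_combB subrK.
Qed.

(** From left to right, both parts of the splitting are diagonal in the same orthonormal basis [P],
    hence commute. Conversely, a common eigenbasis with eigenvalues [a] of [S] and [b] of [N] gives
    [L = diag_mx (a + b)], and the weights [b] are feasible with value zero because [0 <= a]. *)
Lemma G_com : G R n = com (psdmx R n) (nnegmx R n).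
Proof.
apply/seteqP; split => A.
  move=> [symA [P [L [PP DL AE /alpha_attained[w [wL w0]]]]]].
  pose d : 'rV[R]_n := \row_k (L k k - w k).
  pose e : 'rV[R]_n := \row_k w k.
  have combd : comb P (d 0) =
      rank1_comb (fun k => col k P) (fun k => L k k - w k).
    by apply: eq_bigr => k _; rewrite mxE.
  have combe : comb P (e 0) = comb P w.
    by apply: eq_bigr => k _; rewrite mxE.
  exists (comb P (d 0)), (comb P (e 0)); split.
  - by rewrite combd; apply: psdmx_rank1_comb => k; rewrite subr_ge0.
  - by rewrite combe; exact: (@nnegmx_rank1_comb _ (fun k => col k P)).
  - have mulP (x y : 'M[R]_n) :
        P *m x *m P^T *m (P *m y *m P^T) =
        P *m (x *m y) *m P^T.
      by rewrite !mulmxA -(mulmxA _ P^T P) PP mulmx1.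
    by rewrite !comb_diag_mx !mulP diag_mxC.
  - rewrite AE comb_diagonal // combd combe.
    by rewrite -(@rank1_combB _ _ _ (fun k => col k P)) subrK.
move=> [S [N [[symS S0] [symN N0] SN ->]]].
have [P [a [b [PP SE NE]]]] := orthogonal_codiag symS symN SN.
(* The eigenvalue [a 0 k] is the quadratic form of [S] at the [k]-th column of [P]. *)
have a0 k : 0 <= a 0 k.
  have Pk : P^T *m col k P = delta_mx k 0 by rewrite colE mulmxA PP mul1mx.
  have := S0 (col k P); rewrite SE !mulmxA -(mulmxA _ P^T) Pk.
  have -> : (col k P)^T *m P = delta_mx 0 k.
    by rewrite -trmx_delta -Pk trmx_mul trmxK.
  by rewrite -rowE -colE !mxE eqxx.
split; first by rewrite /symmx /= linearD /= symS symN.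
exists P, (diag_mx (a + b)); split=> //.
- exact: diag_mx_is_diag.
- by rewrite linearD /= mulmxDr mulmxDl -SE -NE.
- apply: le_ereal_sup_tmp; exists 0%:E => //; exists 0 => //.
  exists (b 0); split; last by move=> i j _; rewrite comb_diag_mx -NE.
  by move=> k; rewrite !mxE eqxx lerDr.
Qed.

Lemma psdmx0 : psdmx R n 0.
Proof. by split=> [|x]; rewrite /symmx /= ?trmx0 // mulmx0 mul0mx mxE. Qed.

Lemma nnegmx0 : nnegmx R n 0.
Proof. by split=> [|i j]; rewrite /symmx /= ?trmx0 // mxE. Qed.

Lemma psd_nneg_sub_com :
  psdmx R n `|` nnegmx R n `<=` com (psdmx R n) (nnegmx R n).
Proof.
move=> A [psdA|nnA].
  exists A, 0; split; rewrite ?addr0 ?mulmx0 ?mul0mx //; exact: nnegmx0.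
exists 0, A; split; rewrite ?add0r ?mulmx0 ?mul0mx //; exact: psdmx0.
Qed.

Lemma psdmxZD (k l : R) (A B : 'M[R]_n) : 0 <= k -> 0 <= l ->
  psdmx R n A -> psdmx R n B -> psdmx R n (k *: A + l *: B).
Proof.
move=> k0 l0 [symA A0] [symB B0]; split.
  by rewrite /symmx /= linearD !linearZ /= symA symB.
move=> x; rewrite mulmxDr mulmxDl -!scalemxAr -!scalemxAl.
by rewrite mxE addr_ge0 // mxE mulr_ge0.
Qed.

Lemma nnegmxZD (k l : R) (A B : 'M[R]_n) : 0 <= k -> 0 <= l ->
  nnegmx R n A -> nnegmx R n B -> nnegmx R n (k *: A + l *: B).
Proof.
move=> k0 l0 [symA A0] [symB B0]; split.
  by rewrite /symmx /= linearD !linearZ /= symA symB.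
by move=> i j; rewrite !mxE addr_ge0 // mulr_ge0.
Qed.

(** One inclusion holds because the sum of the cones is convex, each being closed under nonnegative
    combinations. For the other, the doubled summands lie in [X] and their midpoint is [S + N]. *)
Lemma convex_hull_psd_nneg (X : set 'M[R]_n) :
  psdmx R n `|` nnegmx R n `<=` X ->
  X `<=` minkowski_sum (psdmx R n) (nnegmx R n) ->
  convex_hull X = minkowski_sum (psdmx R n) (nnegmx R n).
Proof.
move=> subX Xsub; apply/seteqP; split.
  apply: smallest_sub => // A B t /set_mem[S [N [pS nN ->]]]
    /set_mem[S' [N' [pS' nN' ->]]]; apply/mem_set.
  have t0 : 0 <= t%:num := ge0 t.
  have t1 : 0 <= (1 - t%:num) by rewrite subr_ge0 le1.
  exists (t%:num *: S + (1 - t%:num) *: S'), (t%:num *: N + (1 - t%:num) *: N').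
  split; [exact: psdmxZD | exact: nnegmxZD | ].
  by rewrite addrACA -!scalerDr.
move=> _ [S [N [pS nN ->]]] Y [convY XY].
have psd2 : Y (2 *: S).
  apply/XY/subX; left; rewrite -[_ *: S]addr0 -(scale0r S).
  exact: psdmxZD.
have nn2 : Y (2 *: N).
  apply/XY/subX; right; rewrite -[_ *: N]addr0 -(scale0r N).
  exact: nnegmxZD.
have half_ge0 : 0 <= 2^-1 :> R by rewrite invr_ge0.
have half_le1 : 2^-1 <= 1 :> R by rewrite invf_le1 // ler1n.
have /set_mem := convY _ _ (Itv01 half_ge0 half_le1) (mem_set psd2) (mem_set nn2).
rewrite [X in Y X](_ : _ = 2^-1 *: (2 *: S) + (1 - 2^-1) *: (2 *: N)) //.
have -> : 1 - 2^-1 = 2^-1 :> R by field.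
by rewrite !scalerA mulVf ?pnatr_eq0 // !scale1r.
Qed.

End LinearPrograms.

(** * Matrices of order two *)

Lemma quad2E (R : realType) (A : 'M[R]_2) (x : 'cV[R]_2) : A^T = A ->
  (x^T *m A *m x) 0 0 =
  A 0 0 * x 0 0 ^+ 2 + 2 * A 0 1 * (x 0 0 * x 1 0) + A 1 1 * x 1 0 ^+ 2.
Proof.
move=> symA; rewrite mxE !big_ord_recl big_ord0 !mxE !big_ord_recl !big_ord0 !mxE.
have -> : lift ord0 ord0 = 1 :> 'I_2 by apply/val_inj.
have -> : A 1 0 = A 0 1 by rewrite -{1}symA mxE.
have -> : ord0 = 0 :> 'I_2 by apply/val_inj.
by ring.
Qed.

(** The diagonal of [S + N] is nonnegative, so the sign of the off-diagonal entry decides. If that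
    entry is negative, the form of [S + N] is nonnegative at every [x]: when [x 0 0 * x 1 0] is
    nonnegative so is the form of [N], and otherwise all three terms of [quad2E] for [S + N] are
    nonnegative. *)
Lemma psd_nneg_sum2 (R : realType) :
  minkowski_sum (psdmx R 2) (nnegmx R 2) `<=` psdmx R 2 `|` nnegmx R 2.
Proof.
move=> _ [S [N [[symS S0] [symN N0] ->]]].
have symA : (S + N)^T = S + N by rewrite linearD /= symS symN.
have S00 : 0 <= S 0 0.
  by have := S0 (delta_mx 0 0); rewrite quad2E // !mxE /=; lra.
have S11 : 0 <= S 1 1.
  by have := S0 (delta_mx 1 0); rewrite quad2E // !mxE /=; lra.
have N00 := N0 0 0; have N11 := N0 1 1; have N01 := N0 0 1.
have [b0|b0] := leP 0 ((S + N) 0 1); [right|left]; split=> //.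
  have b0' : 0 <= (S + N) 1 0 by rewrite -symA mxE.
  have or2 (i : 'I_2) : i = 0 \/ i = 1.
    by case: i => [[|[|//]]] ?; [left|right]; apply/val_inj.
  move=> i j; case: (or2 i) => ->; case: (or2 j) => -> //; rewrite mxE addr_ge0 //.
move=> x; have [x0|x0] := leP 0 (x 0 0 * x 1 0).
  rewrite mulmxDr mulmxDl mxE addr_ge0 // quad2E //.
  by rewrite !addr_ge0 // mulr_ge0 ?sqr_ge0 // mulr_ge0.
rewrite quad2E // !addr_ge0 //.
- by rewrite mulr_ge0 ?sqr_ge0 // mxE addr_ge0.
- by rewrite -mulrA mulr_ge0 // mulr_le0 // ltW.
- by rewrite mulr_ge0 ?sqr_ge0 // mxE addr_ge0.
Qed.

(** * Assembly of the inclusions *)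

Theorem corollary3p4 (R : realType) (n : nat) (n_gt0 : (0 < n)%N) :
  let PSD := psdmx R n in
  let NN := nnegmx R n in
  let SN := minkowski_sum PSD NN in
  (* (i) *)
  (  [/\ PSD `|` NN `<=` G R n, G R n = com PSD NN,
         com PSD NN `<=` G_hat R n & G_hat R n `<=` SN]
  /\ [/\ PSD `|` NN `<=` F_plus R n, F_plus R n `<=` F_plus_hat R n &
         F_plus_hat R n `<=` SN]
  /\ [/\ PSD `|` NN `<=` F_pm R n, F_pm R n `<=` F_pm_hat R n &
         F_pm_hat R n `<=` SN]
  /\ (G R n `<=` F_plus R n /\ F_plus R n `<=` F_pm R n)
  /\ (G_hat R n `<=` F_plus_hat R n /\ F_plus_hat R n `<=` F_pm_hat R n))
  (* (ii) *)
  /\ (n = 2%N ->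
      [/\ F_plus R n = SN, F_plus_hat R n = SN,
          F_pm R n = SN & F_pm_hat R n = SN])
  (* (iii) *)
  /\ [/\ convex_hull (F_plus R n) = SN, convex_hull (F_plus_hat R n) = SN,
         convex_hull (F_pm R n) = SN & convex_hull (F_pm_hat R n) = SN].
Proof.
move=> PSD NN SN; rewrite /SN /NN /PSD {SN NN PSD}.
have comG : com (psdmx R n) (nnegmx R n) = G R n by rewrite G_com.
have subG : psdmx R n `|` nnegmx R n `<=` G R n.
  by rewrite -comG; exact: psd_nneg_sub_com.
have GP : G R n `<=` F_plus R n.
  by apply: factor_set_mono => // P L; exact: le_alpha_alpha_plus.
have PM : F_plus R n `<=` F_pm R n.
  by apply: factor_set_mono => // P L; exact: le_alpha_plus_pm.
have GPh : G_hat R n `<=` F_plus_hat R n.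
  by apply: factor_set_mono => // P L; exact: le_alpha_alpha_plus.
have PMh : F_plus_hat R n `<=` F_pm_hat R n.
  by apply: factor_set_mono => // P L; exact: le_alpha_plus_pm.
have GGh : G R n `<=` G_hat R n by exact: factor_set_mono.
have PPh : F_plus R n `<=` F_plus_hat R n by exact: factor_set_mono.
have MMh : F_pm R n `<=` F_pm_hat R n by exact: factor_set_mono.
(* [G] is contained in all the other factor sets and [F_pm_hat] contains them all, so the remaining
   inclusions follow by transitivity. *)
have MhS := @F_pm_hat_sub R n.
have PhS := subset_trans PMh MhS.
have subP := subset_trans subG GP.
have subM := subset_trans subP PM.
have subPh := subset_trans subP PPh.
have subMh := subset_trans subM MMh.
have PS := subset_trans PPh PhS.
have MS := subset_trans MMh MhS.
split; [|split].
- have GhS := subset_trans GPh PhS.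
  rewrite comG; split; first by [].
  by split; [|split; [|split]].
- move=> n2; have SNsub : minkowski_sum (psdmx R n) (nnegmx R n) `<=`
      psdmx R n `|` nnegmx R n by rewrite n2; exact: psd_nneg_sum2.
  by split; apply/seteqP; split => //; apply: subset_trans SNsub _.
- by split; apply: convex_hull_psd_nneg.
Qed.
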